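(* Let $d\ge3$, let $s\in[\tfrac14,\tfrac12]$, and suppose that $E\subseteq S_j\subset\mathbb{F}_q^d$, with $j\in\mathbb{F}_q$, $j\neq0$, is a $(4,s)$-Salem set. If $$|E|\gg q^{\frac{d+1}{4s+1}},$$ then $|\Delta(E)|\gg q$.
   Context: $\mathbb{F}_q$ is a finite field of odd order $q$; for $\mathbf{x}\in\mathbb{F}_q^d$, $\|\mathbf{x}\|=x_1^2+\cdots+x_d^2$; $S_j=\{\mathbf{x}\in\mathbb{F}_q^d:\|\mathbf{x}\|=j\}$; $\Delta(E)=\{\|\mathbf{x}-\mathbf{y}\|:\mathbf{x},\mathbf{y}\in E\}$. Fix a nontrivial additive character $\chi$ of $\mathbb{F}_q$ and put $\widehat{E}(\mathbf{x})=q^{-d}\sum_{\mathbf{y}\in E}\chi(-\mathbf{x}\cdot\mathbf{y})$ and $\|\widehat{E}\|_4=\big(q^{-d}\sum_{\mathbf{x}\in\mathbb{F}_q^d\setminus\{\mathbf{0}\}}|\widehat{E}(\mathbf{x})|^4\big)^{1/4}$. A set $E\subseteq\mathbb{F}_q^d$ is $(4,s)$-Salem if $\|\widehat{E}\|_4\ll q^{-d}|E|^{1-s}$. Notation: $A\ll B$ (equivalently $B\gg A$) means $A\le CB$ for a constant $C>0$ not depending on $q$ or on the sets involved. Implied constants in conclusions may depend on $d$, $s$ and on the implied constants in the hypotheses (including the one in the Salem condition). *)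

(* Defs.v *)
From HB Require Import structures.
From mathcomp Require Import all_boot all_order all_algebra.
From mathcomp Require Import reals exp.
From mathcomp Require Import complex.

Set Implicit Arguments.
Unset Strict Implicit.
Unset Printing Implicit Defensive.

Import Order.TTheory GRing.Theory Num.Theory.

Local Open Scope ring_scope.
Local Open Scope complex_scope.

(* [cabs] is the R-valued modulus on the complex numbers R[i]; the generic norm
   there takes its values in R[i]. *)

Notation cabs := ComplexField.Normc.normc.

Section Space.
Variables (F : finFieldType) (d : nat).
Implicit Types (x y : 'rV[F]_d) (E : {set 'rV[F]_d}) (j : F).

Definition dotv x y : F := \sum_(i < d) x 0 i * y 0 i.

(* The F-valued quadratic form written ||x||. *)
Definition qnorm x : F := \sum_(i < d) x 0 i ^+ 2.

Definition qsphere j : {set 'rV[F]_d} := [set x | qnorm x == j].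

Definition distset E : {set F} := [set qnorm (x - y) | x in E, y in E].

End Space.

Arguments qsphere F d j : clear implicits.

Section Fourier.
Variables (R : realType) (F : finFieldType).

(* Homomorphisms from (F, +) to the complex unit circle; chi 0 = 1 follows. *)
Definition additive_character (chi : F -> R[i]) : Prop :=
  (forall a b : F, chi (a + b) = chi a * chi b) /\
  (forall a : F, cabs (chi a) = 1).

Definition nontrivial_additive_character (chi : F -> R[i]) : Prop :=
  additive_character chi /\ exists a : F, chi a != 1.

Variables (chi : F -> R[i]) (d : nat).
Implicit Types (E : {set 'rV[F]_d}).

Definition fourier E (x : 'rV[F]_d) : R[i] :=
  (#|F|%:R ^+ d)^-1 * \sum_(y in E) chi (- dotv x y).

Definition fourier_norm4 E : R :=
  ((#|F|%:R ^+ d)^-1 * \sum_(x : 'rV[F]_d | x != 0) cabs (fourier E x) ^+ 4)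
    `^ (1 / 4).

(* C is the implied constant of the (4, s)-Salem condition. *)
Definition salem4 (C s : R) E : Prop :=
  fourier_norm4 E <= C * (#|F|%:R ^+ d)^-1 * #|E|%:R `^ (1 - s).

End Fourier.

(* Main.v *)
(* On the sphere, ||x - y|| = 2 j - 2 x.y, so |Delta(E)| is bounded below by
   Cauchy-Schwarz from the number of triples (x, y, z) in E^3 with x.y = x.z,
   which by orthogonality is |E|^3 / q plus 1/q times the sum, over x in E and
   r != 0, of q^(2d) |E^(r x)|^2. A second Cauchy-Schwarz bounds this error by the
   fourth moment of E^, because (x, r) |-> r x is at most two-to-one on
   S_j x F^*; the Salem condition then makes it O(|E|^3 / q). *)
Require Import Defs.
From HB Require Import structures.
From mathcomp Require Import all_boot all_order all_algebra.
From mathcomp Require Import finfield ring lra.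
From mathcomp Require Import reals exp.
From mathcomp Require Import complex.

Set Implicit Arguments.
Unset Strict Implicit.
Unset Printing Implicit Defensive.

Import Order.TTheory GRing.Theory Num.Theory.

Local Open Scope ring_scope.
Local Open Scope complex_scope.

(** * Cauchy-Schwarz, collision counts and square roots in a finite field *)

Lemma sqr_sum_le_card (R : realFieldType) (I : finType) (P : pred I)
    (f : I -> R) :
  (\sum_(i | P i) f i) ^+ 2 <= #|P|%:R * \sum_(i | P i) f i ^+ 2.
Proof.
set S := \sum_(i | P i) f i; set Q := \sum_(i | P i) f i ^+ 2.
set n : R := #|P|%:R.
(* Cauchy-Schwarz comes from the nonnegativity of a variance, scaled by [n] to avoid division; the
   empty index set is treated apart. *)
have var : \sum_(i | P i) (n * f i - S) ^+ 2 = n * (n * Q - S ^+ 2).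
  transitivity (\sum_(i | P i)
      (n ^+ 2 * f i ^+ 2 - 2 * n * S * f i + S ^+ 2)).
    by apply: eq_bigr => i _; ring.
  rewrite big_split sumrB -!mulr_sumr sumr_const -/S -/Q -mulr_natl -/n /=.
  by ring.
have var_ge0 : 0 <= n * (n * Q - S ^+ 2).
  by rewrite -var sumr_ge0 // => i _; rewrite sqr_ge0.
have [n0|n_gt0] := posnP #|P|.
  have S0 : S = 0.
    by apply: big_pred0 => i; move/card0_eq: n0 => /(_ i).
  by rewrite S0 /n n0 expr0n mul0r.
by move: var_ge0; rewrite pmulr_rge0 ?ltr0n // subr_ge0.
Qed.

(** With [m t] the size of the fibre over [t], the values of [m] on the image sum to [#|A|] and
    their squares to the collision count; Cauchy-Schwarz compares the two. *)
Lemma card_sqr_le_collisions (R : realFieldType) (T U : finType) (f : T -> U)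
    (A : {set T}) :
  #|A|%:R ^+ 2 <=
    #|f @: A|%:R * \sum_(y in A) \sum_(z in A) (f y == f z)%:R :> R.
Proof.
pose m t : R := \sum_(z in A) (t == f z)%:R.
have fib t : \sum_(y in A | f y == t) 1 = m t.
  by rewrite big_mkcondr; apply: eq_bigr => y _; rewrite eq_sym; case: eqP.
have part (g : U -> R) :
    \sum_(y in A) g (f y) = \sum_(t in f @: A) g t * m t.
  rewrite (partition_big f [in f @: A]) => [|y yA]; last exact: imset_f.
  apply: eq_bigr => t _; rewrite -fib mulr_sumr.
  by apply: eq_bigr => y /andP[_ /eqP->]; rewrite mulr1.
have -> : #|A|%:R = \sum_(t in f @: A) m t.
  rewrite -sumr_const (part (fun=> 1)).
  by apply: eq_bigr => t _; rewrite mul1r.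
rewrite (part m); exact: sqr_sum_le_card.
Qed.

(** In characteristic 2 the order would be a power of 2 above 1, hence even. *)
Lemma odd_card_nat2_neq0 (F : finFieldType) : odd #|F| -> 2%:R != 0 :> F.
Proof.
apply: contraL => /eqP F2.
have pc2 : 2 \in [pchar F] by rewrite inE /= F2 eqxx.
have := card_finNzRing_gt1 F; rewrite (card_pprimeChar pc2).
by case: (logn _ _) => // k _; rewrite oddX.
Qed.

Lemma card_square_roots_le2 (F : finFieldType) (a : F) :
  (#|[set r : F | r ^+ 2 == a]| <= 2)%N.
Proof.
have [->|[r0]] := set_0Vmem [set r : F | r ^+ 2 == a]; first by rewrite cards0.
rewrite inE => /eqP <-.
have le2 : (#|[set r0; - r0]| <= 2)%N by rewrite cards2; case: eqP.
apply: leq_trans le2; apply/subset_leq_card/subsetP => r.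
by rewrite !inE eqf_sqr.
Qed.

(** * The quadratic form and dilates of the sphere *)

Section Quadratic.
Variables (F : finFieldType) (d : nat).
Implicit Types (x y : 'rV[F]_d) (r : F).

Lemma dotvZl r x y : dotv (r *: x) y = r * dotv x y.
Proof. by rewrite mulr_sumr; apply: eq_bigr => i _; rewrite mxE mulrA. Qed.

Lemma qnormZ r x : qnorm (r *: x) = r ^+ 2 * qnorm x.
Proof. by rewrite mulr_sumr; apply: eq_bigr => i _; rewrite mxE exprMn. Qed.

Lemma qnormB x y : qnorm (x - y) = qnorm x + qnorm y - 2%:R * dotv x y.
Proof.
rewrite mulr_sumr -big_split -sumrB; apply: eq_bigr => i _ /=.
by rewrite !mxE; ring.
Qed.

Lemma qnorm0 : qnorm (0 : 'rV[F]_d) = 0.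
Proof. by apply: big1 => i _; rewrite mxE expr0n. Qed.

(* A vector [v] is of the form [r *: x] with [x] on the sphere for at most two
   scalars [r], since [qnorm v = r ^+ 2 * j]. *)
Lemma sum_cone_le (R : realFieldType) (j : F) (E : {set 'rV[F]_d})
    (g : 'rV[F]_d -> R) :
  j != 0 -> E \subset qsphere F d j -> (forall v, 0 <= g v) ->
  \sum_(x in E) \sum_(r | r != 0) g (r *: x) <= 2 * \sum_(v | v != 0) g v.
Proof.
move=> j0 /subsetP Ej g0; rewrite exchange_big /=.
have scale r : r != 0 -> \sum_(x in E) g (r *: x) =
    \sum_(v | v != 0) (r^-1 *: v \in E)%:R * g v.
  move=> r0; rewrite big_mkcond [RHS]big_mkcond [RHS](reindex_inj (scalerI r0)).
  apply: eq_bigr => x _; rewrite scalerK // scaler_eq0 (negPf r0) /=.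
  (* Only [x = 0] could break the match, and [j != 0] keeps it off the sphere. *)
  have [->|] := eqVneq x 0; last by case: (x \in E); rewrite ?mul1r ?mul0r.
  case: ifP => // /Ej; rewrite inE qnorm0 eq_sym (negPf j0) //.
rewrite (eq_bigr _ scale) exchange_big mulr_sumr /=.
apply: ler_sum => v _; rewrite -mulr_suml ler_wpM2r //.
apply: le_trans (_ : #|[set r : F | r ^+ 2 == qnorm v / j]|%:R <= _); last first.
  by rewrite ler_nat card_square_roots_le2.
rewrite -sumr_const big_mkcond [leRHS]big_mkcond /=.
apply: ler_sum => r _; rewrite inE.
have [->|r0] := eqVneq r 0; first by case: ifP.
case: (boolP (_ \in E)) => [/Ej|]; last by case: ifP.
rewrite inE qnormZ exprVn => /eqP jE.
suff -> : r ^+ 2 = qnorm v / j by rewrite eqxx.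
by apply: (canRL (mulfK j0)); rewrite -jE mulrA divff ?expf_neq0 // mul1r.
Qed.

End Quadratic.

(** * Additive characters and exponential sums *)

Section Character.
Variables (R : realType) (F : finFieldType) (chi : F -> R[i]).
Hypothesis chi_nontriv : nontrivial_additive_character chi.

Let chiD a b : chi (a + b) = chi a * chi b.
Proof. by case: chi_nontriv => -[]. Qed.

Let cabs_chi a : cabs (chi a) = 1.
Proof. by case: chi_nontriv => -[]. Qed.

Lemma sqr_cabs (z : R[i]) : (cabs z ^+ 2)%:C = z * z^*%C.
Proof. by rewrite -sqr_normc rmorphXn. Qed.

Lemma cabsE (z : R[i]) : (cabs z)%:C = `|z|.
Proof. by rewrite normc_def; case: z. Qed.

Lemma cabs_ge0 (z : R[i]) : 0 <= cabs z.
Proof. by case: z => a b; apply: sqrtr_ge0. Qed.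

Lemma char0 : chi 0 = 1.
Proof.
have chi_neq0 : chi 0 != 0.
  apply/eqP => e; move: (cabs_chi 0).
  by rewrite e Normc.normc0 => /eqP; rewrite eq_sym oner_eq0.
by apply: (mulfI chi_neq0); rewrite -chiD addr0 mulr1.
Qed.

Lemma charN a : chi (- a) = (chi a)^*%C.
Proof.
have chiJ : chi a * (chi a)^*%C = 1 by rewrite -sqr_cabs cabs_chi expr1n.
have chi_neq0 : chi a != 0.
  by apply: contraTneq (oner_neq0 R[i]) => a0; rewrite -chiJ a0 mul0r eqxx.
by apply: (mulfI chi_neq0); rewrite -chiD subrr char0 chiJ.
Qed.

(** Orthogonality: for [b != 0], shifting [r] by [a / b] with [chi a != 1] multiplies the sum by
    [chi a], so it vanishes. *)
Lemma char_sum (b : F) : \sum_r chi (r * b) = #|F|%:R * (b == 0)%:R.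
Proof.
have [->|b0] := eqVneq b 0.
  rewrite (eq_bigr (fun=> 1)) => [|r _]; last by rewrite mulr0 char0.
  by rewrite sumr_const mulr1.
have [_ [a chia]] := chi_nontriv; rewrite mulr0; apply/eqP.
have shift : \sum_r chi (r * b) = chi a * \sum_r chi (r * b).
  rewrite mulr_sumr [LHS](reindex_inj (addrI (a / b))) /=.
  by apply: eq_bigr => r _; rewrite mulrDl divfK // chiD.
have /eqP : (1 - chi a) * \sum_r chi (r * b) = 0.
  by rewrite mulrBl mul1r -shift subrr.
by rewrite mulf_eq0 subr_eq0 eq_sym (negPf chia).
Qed.

Variable (d : nat).
Implicit Types (E : {set 'rV[F]_d}) (x : 'rV[F]_d).

(** The unnormalised Fourier transform, [#|F| ^ d] times [fourier]. *)
Definition exp_sum E x : R[i] := \sum_(y in E) chi (- dotv x y).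

(** Expanding the square and summing over [r] first, orthogonality keeps only the pairs with
    [dotv x y = dotv x z]. *)
Lemma sum_line_exp_sum E x :
  \sum_r cabs (exp_sum E (r *: x)) ^+ 2 =
  #|F|%:R * \sum_(y in E) \sum_(z in E) (dotv x y == dotv x z)%:R.
Proof.
apply: (@complexI R); rewrite rmorph_sum rmorphM !rmorph_nat rmorph_sum /=.
transitivity (\sum_r \sum_(y in E) \sum_(z in E)
    chi (r * (dotv x z - dotv x y))).
  apply: eq_bigr => r _; rewrite sqr_cabs /exp_sum rmorph_sum mulr_suml /=.
  apply: eq_bigr => y _; rewrite mulr_sumr; apply: eq_bigr => z _.
  by rewrite -charN -chiD opprK !dotvZl mulrBr addrC.
rewrite exchange_big mulr_sumr; apply: eq_bigr => y _.
rewrite exchange_big rmorph_sum mulr_sumr; apply: eq_bigr => z _.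
by rewrite char_sum subr_eq0 eq_sym rmorph_nat.
Qed.

(** Of the five normalising factors, four come from [fourier] and one from the average in the
    norm. *)
Lemma fourier_norm4_pow E :
  fourier_norm4 chi E ^+ 4 =
  (#|F|%:R ^+ d)^-1 ^+ 5 * \sum_(x | x != 0) cabs (exp_sum E x) ^+ 4.
Proof.
rewrite /fourier_norm4 -powR_mulrn ?powR_ge0 // -powRrM div1r mulVf ?pnatr_eq0 //.
have cabs4 x : cabs (fourier chi E x) ^+ 4 =
    (#|F|%:R ^+ d)^-1 ^+ 4 * cabs (exp_sum E x) ^+ 4.
  rewrite /fourier Normc.normcM Normc.normcV exprMn; congr (_ ^+ _ * _).
  congr (_^-1); apply: (@complexI R); rewrite cabsE normrX normr_nat.
  by rewrite rmorphXn /= rmorph_nat.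
rewrite (eq_bigr _ (fun x _ => cabs4 x)) -mulr_sumr mulrA -exprS powRr1 //.
rewrite mulr_ge0 ?exprn_ge0 ?invr_ge0 ?exprn_ge0 ?ler0n // sumr_ge0 // => x _.
by rewrite exprn_ge0 ?cabs_ge0.
Qed.

End Character.

(** * Distances on the sphere and the energy of dilates *)

Section SphereEnergy.
Variables (R : realType) (F : finFieldType) (chi : F -> R[i]) (d : nat).
Variables (j : F) (E : {set 'rV[F]_d}).
Hypothesis oddF : odd #|F|.
Hypothesis chi_nontriv : nontrivial_additive_character chi.
Hypothesis j_neq0 : j != 0.
Hypothesis Ej : E \subset qsphere F d j.

(** Distances from the single point [x] already lie in [distset E]; as all norms equal [j] and 2 is
    invertible, they collide exactly when the dot products with [x] agree. *)
Lemma card_pinned_distances x : x \in E ->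
  #|E|%:R ^+ 2 <= #|distset E|%:R *
    \sum_(y in E) \sum_(z in E) (dotv x y == dotv x z)%:R :> R.
Proof.
move=> xE; have sphE y : y \in E -> qnorm y = j.
  by move=> /(subsetP Ej); rewrite inE => /eqP.
apply: le_trans (@card_sqr_le_collisions R _ _ (fun y => qnorm (x - y)) E) _.
rewrite -[leRHS](_ : #|distset E|%:R *
    \sum_(y in E) \sum_(z in E) (qnorm (x - y) == qnorm (x - z))%:R = _).
  apply: ler_wpM2r.
    by rewrite sumr_ge0 // => y _; rewrite sumr_ge0 // => z _; rewrite ler0n.
  rewrite ler_nat subset_leq_card //; apply/subsetP => t /imsetP[y yE ->].
  exact: imset2_f.
congr (_ * _); apply: eq_bigr => y yE; apply: eq_bigr => z zE.
rewrite !qnormB !sphE // (inj_eq (addrI _)) eqr_opp.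
by rewrite (inj_eq (mulfI (odd_card_nat2_neq0 oddF))).
Qed.

(** The error term: the contribution of [r != 0] to [#|F|] times the triple count. *)
Definition cone_energy : R :=
  \sum_(x in E) \sum_(r | r != 0) cabs (exp_sum chi E (r *: x)) ^+ 2.

Lemma card_cube_le_distances :
  #|F|%:R * #|E|%:R ^+ 3 <=
    #|distset E|%:R * (#|E|%:R ^+ 3 + cone_energy).
Proof.
have energyE : #|E|%:R ^+ 3 + cone_energy = #|F|%:R *
    \sum_(x in E) \sum_(y in E) \sum_(z in E) (dotv x y == dotv x z)%:R.
  have -> : #|E|%:R ^+ 3 = \sum_(x in E) #|E|%:R ^+ 2 :> R.
    by rewrite sumr_const exprS mulr_natl.
  rewrite -big_split mulr_sumr; apply: eq_bigr => x _ /=.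
  (* The term [r = 0] is the main term, since [exp_sum] at the origin is [#|E|]. *)
  rewrite -(sum_line_exp_sum chi_nontriv) [RHS](bigD1 0) //=; congr (_ ^+ 2 + _).
  apply: (@complexI R); rewrite cabsE /exp_sum scale0r.
  rewrite (eq_bigr (fun=> 1)) ?sumr_const ?normr_nat ?rmorph_nat // => y _.
  have -> : dotv 0 y = 0 by apply: big1 => i _; rewrite mxE mul0r.
  by rewrite oppr0 (char0 chi_nontriv).
rewrite energyE [leRHS]mulrCA ler_wpM2l ?ler0n // exprS mulr_natl -sumr_const mulr_sumr.
exact: ler_sum card_pinned_distances.
Qed.

Lemma cone_energy_ge0 : 0 <= cone_energy.
Proof.
by rewrite sumr_ge0 // => x _; rewrite sumr_ge0 // => r _; rewrite sqr_ge0.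
Qed.

(** Cauchy-Schwarz over at most [#|E| * #|F|] pairs [(x, r)], then [sum_cone_le] applied to fourth
    powers. *)
Lemma sqr_cone_energy_le :
  cone_energy ^+ 2 <= #|E|%:R * #|F|%:R *
    (2 * \sum_(v | v != 0) cabs (exp_sum chi E v) ^+ 4).
Proof.
have cone4 := sum_cone_le j_neq0 Ej
  (fun v => exprn_ge0 4 (cabs_ge0 (exp_sum chi E v))).
rewrite /cone_energy pair_big /=; apply: le_trans (sqr_sum_le_card _ _) _.
apply: ler_pM; first by rewrite ler0n.
- by rewrite sumr_ge0 // => i _; rewrite sqr_ge0.
- rewrite -natrM ler_nat (_ : #|_| = #|E| * #|[pred r : F | r != 0%R]|)%N.
    by rewrite leq_mul2l max_card orbT.
  exact: (cardX E [pred r : F | r != 0]).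
rewrite -(pair_big (mem E) (fun r => r != 0)
  (fun x r => (cabs (exp_sum chi E (r *: x)) ^+ 2) ^+ 2)) /=.
apply: le_trans cone4; apply: ler_sum => x _; apply: ler_sum => r _.
by rewrite -exprM.
Qed.

End SphereEnergy.

(** * Choice of constants and conclusion *)

Unset Implicit Arguments.

Theorem theorem10 (R : realType) (d : nat) (s : R) (C K : R)
    (hd : (3 <= d)%N) (hs : 1 / 4 <= s <= 1 / 2) (hC : 0 < C) (hK : 0 < K) :
  exists2 c : R, 0 < c &
    forall (F : finFieldType) (chi : F -> R[i]) (j : F) (E : {set 'rV[F]_d}),
      odd #|F| ->
      nontrivial_additive_character chi ->
      j != 0 ->
      E \subset qsphere F d j ->
      salem4 chi C s E ->
      K * #|F|%:R `^ ((d%:R + 1) / (4 * s + 1)) <= #|E|%:R ->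
      c * #|F|%:R <= #|distset E|%:R.
Proof.
(* [B2] is the constant in [cone_energy ^ 2 <= B2 * n ^ 6]: 2 from the two-to-one dilation, [C ^+ 4]
   from the Salem condition, the last factor from the size hypothesis. *)
pose a := 4 * s + 1; pose B2 := 2 * C ^+ 4 * K^-1 `^ a.
have a_gt0 : 0 < a by rewrite /a; lra.
have B2_ge0 : 0 <= B2.
  by rewrite mulr_ge0 ?powR_ge0 // mulr_ge0 ?exprn_ge0 // ltW.
have B1_gt0 : 0 < 1 + Num.sqrt B2 by rewrite ltr_wpDr ?sqrtr_ge0.
exists (1 + Num.sqrt B2)^-1; first by rewrite invr_gt0.
move=> F chi j E oddF chiP j0 Ej salem largeE.
rewrite mulrC ler_pdivrMr //.
pose q : R := #|F|%:R; pose n : R := #|E|%:R.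
have q_gt0 : 0 < q by rewrite ltr0n (ltn_trans _ (card_finNzRing_gt1 F)).
have n_gt0 : 0 < n.
  by apply: lt_le_trans largeE; rewrite mulr_gt0 ?powR_gt0.
have n3_gt0 : 0 < n ^+ 3 by rewrite exprn_gt0.
set M := \sum_(v | v != 0) cabs (exp_sum chi E v) ^+ 4.
(* The fourth power of the Salem condition, where [q ^ (5d)] against [q ^ (-4d)] leaves [q ^ d]. *)
have M_le : M <= C ^+ 4 * q ^+ d * n `^ (1 - s) ^+ 4.
  have : fourier_norm4 chi E ^+ 4 <= (C * (q ^+ d)^-1 * n `^ (1 - s)) ^+ 4.
    by rewrite lerXn2r // nnegrE ?powR_ge0 // !mulr_ge0 ?powR_ge0 ?invr_ge0
      ?exprn_ge0 // ltW.
  rewrite fourier_norm4_pow -/M -/q.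
  have := exprn_gt0 d q_gt0; set Q := q ^+ d => Q_gt0.
  rewrite -(ler_pM2l (exprn_gt0 5 Q_gt0)) exprVn mulVKf ?expf_neq0 ?gt_eqF //.
  move=> /le_trans-> //; rewrite le_eqVlt; apply/orP; left; apply/eqP.
  by field; rewrite gt_eqF.
(* The size hypothesis raised to the power [a]. *)
have qd_le : q ^+ d * q <= n `^ a * K^-1 `^ a.
  have -> : q ^+ d * q = (q `^ ((d%:R + 1) / a)) `^ a.
    rewrite -powRrM divfK ?gt_eqF // natr1 powR_mulrn ?ltW // exprSr //.
  rewrite -powRM ?invr_ge0 ?(ltW n_gt0) ?(ltW hK) //.
  apply: ge0_ler_powR; first exact: ltW.
  - by rewrite nnegrE powR_ge0.
  - by rewrite nnegrE divr_ge0 // ltW.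
  by rewrite ler_pdivlMr // mulrC.
(* The exponents [1 + (4s + 1) + 4(1 - s)] add up to 6 for every [s], so the error matches the main
   term [n ^+ 3]. *)
have n_pow : n * n `^ a * n `^ (1 - s) ^+ 4 = (n ^+ 3) ^+ 2.
  rewrite -exprM -!powR_mulrn ?powR_ge0 ?ltW // -powRrM.
  rewrite -{1}[n]powRr1 ?ltW // -!powRD ?(gt_eqF n_gt0) ?implybT //.
  by congr (_ `^ _); rewrite /a; ring.
have energy_le : cone_energy chi E <= Num.sqrt B2 * n ^+ 3.
  rewrite -ler_sqr ?nnegrE ?cone_energy_ge0 ?mulr_ge0 ?sqrtr_ge0 ?(ltW n3_gt0) //.
  apply: le_trans (sqr_cone_energy_le chi j0 Ej) _.
  rewrite -/M -/q -/n exprMn sqr_sqrtr // -n_pow.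
  apply: (@le_trans _ _ (n * q * (2 * (C ^+ 4 * q ^+ d * n `^ (1 - s) ^+ 4)))).
    by rewrite ler_wpM2l ?mulr_ge0 ?(ltW n_gt0) ?(ltW q_gt0) // ler_wpM2l.
  rewrite [leLHS](_ : _ =
    (2 * C ^+ 4 * n * n `^ (1 - s) ^+ 4) * (q ^+ d * q)); last by ring.
  rewrite [leRHS](_ : _ =
    (2 * C ^+ 4 * n * n `^ (1 - s) ^+ 4) * (n `^ a * K^-1 `^ a)); last first.
    by rewrite /B2; ring.
  by rewrite ler_wpM2l // !mulr_ge0 ?exprn_ge0 ?powR_ge0 // ltW.
rewrite -(ler_pM2r n3_gt0) -/q.
apply: le_trans (card_cube_le_distances oddF chiP Ej) _.
by rewrite -mulrA ler_wpM2l ?ler0n // mulrDl mul1r lerD2l.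
Qed.
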